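(* If $\Gamma$ is a cactus graph then, for any $n\in\mathbb N$, $\sim_n$ is an equivalence relation on the set of simple paths of $\Gamma$ with fixed endpoints (for any choice of the endpoints).
   Context: A graph $\Gamma=(V,E)$ (possibly infinite) is undirected, has no self-loops, but may have multiple edges between two vertices. A path is a sequence of edges $(e_1,\ldots,e_n)$ such that each $e_i$ connects vertices $v_{i-1}$ and $v_i$, $i=1,\ldots,n$; it is also written $[v_0,v_1,\ldots,v_n]$, and its length is the number $n$ of edges. It is simple if $v_0,\ldots,v_n$ are all different. It is a cycle if $v_0,\ldots,v_{n-1}$ are all different, $v_n=v_0$, and its edges are distinct. Simple paths (with given endpoints) and cycles are viewed as subsets of $E$. A cactus graph is a connected graph in which any two (distinct) cycles have no more than one common vertex. A path $\gamma$ intersects a cycle $C$ if $\gamma\cap C\neq\emptyset$ as sets of edges. Two paths $\gamma,\delta$ diverge on $C$ if they both intersect $C$ and $C$ is the disjoint union of the edge sets $\gamma\cap C$ and $\delta\cap C$. For simple paths $\gamma,\delta$ with the same endpoints, $\gamma\sim_n\delta$ means that $\gamma$ and $\delta$ do not diverge on any cycle of length $>n$. *)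

(* Defs.v *)
From mathcomp Require Import all_boot.
From mathcomp Require Import boolp classical_sets.

Set Implicit Arguments.
Unset Strict Implicit.
Unset Printing Implicit Defensive.

Local Open Scope classical_set_scope.

(* Parallel edges are distinct elements of [edge] with the same ends.  The order
   of the two ends of an edge carries no meaning: it is forgotten by [connects]. *)
Record graph := Graph {
  vertex : Type;
  edge : Type;
  ends : edge -> vertex * vertex;
  no_loop : forall e, (ends e).1 <> (ends e).2 }.

Definition connects (G : graph) (e : edge G) (u v : vertex G) : Prop :=
  ends e = (u, v) \/ ends e = (v, u).

(* The path [v_0, ..., v_n] with edges e_1, ..., e_n is given by v_0 and the
   sequence of steps (e_1, v_1), ..., (e_n, v_n); its length is the size of this
   sequence. *)
Notation steps G := (seq (edge G * vertex G)).

Fixpoint is_path (G : graph) (x : vertex G) (p : steps G) (y : vertex G) : Prop :=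
  if p is (e, v) :: p' then connects e x v /\ is_path v p' y else x = y.

(* [{classic T}] is T with its classical decidable equality. *)
Definition path_edges (G : graph) (p : steps G) : seq {classic edge G} :=
  unzip1 p.

Definition path_vertices (G : graph) (x : vertex G) (p : steps G) :
    seq {classic vertex G} :=
  x :: unzip2 p.

Record simple_path (G : graph) (x y : vertex G) := SimplePath {
  spath_steps : steps G;
  spath_is_path : is_path x spath_steps y;
  spath_simple : uniq (path_vertices x spath_steps) }.

Definition spath_edges (G : graph) (x y : vertex G) (g : simple_path x y) :
    set (edge G) :=
  [set` path_edges (spath_steps g)].

(* [belast] drops the last vertex v_n = v_0. *)
Record graph_cycle (G : graph) := Cycle {
  cycle_base : vertex G;
  cycle_steps : steps G;
  cycle_nonempty : cycle_steps <> [::];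
  cycle_is_path : is_path cycle_base cycle_steps cycle_base;
  cycle_uniq_vertices :
    uniq (belast (cycle_base : {classic vertex G}) (unzip2 cycle_steps));
  cycle_uniq_edges : uniq (path_edges cycle_steps) }.

Definition cycle_length (G : graph) (C : graph_cycle G) : nat := size (cycle_steps C).

Definition cycle_edges (G : graph) (C : graph_cycle G) : set (edge G) :=
  [set` path_edges (cycle_steps C)].

Definition cycle_vertices (G : graph) (C : graph_cycle G) : set (vertex G) :=
  [set` path_vertices (cycle_base C) (cycle_steps C)].

Definition connected_graph (G : graph) : Prop :=
  forall x y : vertex G, exists p, is_path x p y.

(* Cycles are identified with their edge sets, so changing the base point or the
   direction of travel does not produce a distinct cycle. *)
Definition cactus (G : graph) : Prop :=
  connected_graph G /\
  forall C D : graph_cycle G, cycle_edges C <> cycle_edges D ->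
    is_subset1 (cycle_vertices C `&` cycle_vertices D).

Definition intersects (G : graph) (A : set (edge G)) (C : graph_cycle G) : Prop :=
  A `&` cycle_edges C !=set0.

Definition diverge (G : graph) (A B : set (edge G)) (C : graph_cycle G) : Prop :=
  [/\ intersects A C, intersects B C,
      cycle_edges C = (A `&` cycle_edges C) `|` (B `&` cycle_edges C) &
      (A `&` cycle_edges C) `&` (B `&` cycle_edges C) = set0].

Definition path_sim (G : graph) (n : nat) (x y : vertex G)
    (g d : simple_path x y) : Prop :=
  forall C : graph_cycle G, n < cycle_length C ->
    ~ diverge (spath_edges g) (spath_edges d) C.

(* Main.v *)
Require Import Defs.
From Corelib Require Import RelationClasses.
From mathcomp Require Import all_boot.
From mathcomp Require Import boolp classical_sets.

Set Implicit Arguments.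
Unset Strict Implicit.
Unset Printing Implicit Defensive.

Local Open Scope classical_set_scope.

(** The key fact is that if an edge e of a cycle C lies on a simple path g but
    not on a simple path d with the same endpoints, then C is contained in the
    union of g and d: following g backwards from one end of e, then d, then g
    backwards to the other end of e gives a walk avoiding e, which closes up
    with e to a cycle, and in a cactus this cycle must be C.  If g and h diverge
    on C, applying this to g, d and to h, d shows that d diverges on C from g or
    from h, unless d contains the whole of C; but a simple path contains no
    cycle. *)

(** Arbitrary walks are allowed, so that the relation is transitive and symmetric without any care
    about repeated vertices; [linked_simple] restores simplicity at the end. *)
Definition linked (G : graph) (A : set (edge G)) (x y : vertex G) : Prop :=
  exists2 p, is_path x p y & [set` path_edges p] `<=` A.

Lemma connects_sym (G : graph) (e : edge G) u v : connects e u v -> connects e v u.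
Proof. by case; [right|left]. Qed.

Lemma connects_neq (G : graph) (e : edge G) u v : connects e u v -> u <> v.
Proof. by move=> euv uv; apply: (@no_loop G e); case: euv => ->. Qed.

Lemma is_path_cat (G : graph) (x y z : vertex G) p q :
  is_path x p y -> is_path y q z -> is_path x (p ++ q) z.
Proof.
by elim: p x => [|[e v] p IHp] x /= => [->|[exv pv] qy] //; split=> //; apply: IHp.
Qed.

Lemma linked_sub (G : graph) (A B : set (edge G)) x y :
  A `<=` B -> linked A x y -> linked B x y.
Proof. by move=> AB [p px pA]; exists p => // e /pA /AB. Qed.

Lemma linked_trans (G : graph) (A : set (edge G)) x y z :
  linked A x y -> linked A y z -> linked A x z.
Proof.
move=> [p px pA] [q qy qA]; exists (p ++ q); first exact: is_path_cat px qy.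
move=> e /=; rewrite /path_edges /unzip1 map_cat mem_cat => /orP[]; [exact: pA|exact: qA].
Qed.

Lemma linked_sym (G : graph) (A : set (edge G)) x y : linked A x y -> linked A y x.
Proof.
case=> p; elim: p x => [|[e v] p IHp] x /= => [-> _|[exv pv] pA]; first by exists [::].
apply: (@linked_trans _ _ _ v).
  by apply: IHp => // f fp; apply: pA; rewrite /= inE fp orbT.
exists [:: (e, x)]; first by split=> //; apply: connects_sym.
by move=> f /=; rewrite inE => /eqP->; apply: pA; rewrite /= inE eqxx.
Qed.

Lemma in_path_vertices_cons (G : graph) (x : vertex G) e v p
    (u : {classic vertex G}) :
  (u \in path_vertices x ((e, v) :: p)) = (u == x) || (u \in path_vertices v p).
Proof. exact: in_cons. Qed.

Lemma path_edge_ends (G : graph) (x y : vertex G) p e u v :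
  is_path x p y -> e \in path_edges p -> connects e u v ->
  u \in path_vertices x p /\ v \in path_vertices x p.
Proof.
elim: p x => [|[f w] p IHp] x //= [fxw pw]; rewrite inE => /predU1P[->|ep] euv.
  by rewrite /connects in euv; case: fxw euv => ->; case=> -[<- <-]; rewrite !in_path_vertices_cons mem_head eqxx orbT.
have [up vp] := IHp _ pw ep euv.
by rewrite !in_path_vertices_cons up vp !orbT.
Qed.

Lemma simple_uniq_edges (G : graph) (x y : vertex G) p :
  is_path x p y -> uniq (path_vertices x p) -> uniq (path_edges p).
Proof.
elim: p x => [|[e v] p IHp] x //= [exv pv] /andP[xp up].
rewrite [uniq _](IHp _ pv up) andbT.
by apply: contra xp => ep; have [] := path_edge_ends pv ep exv.
Qed.

(** Only distinctness of edges is assumed, so that this serves simple paths and cycles alike. *)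
Lemma path_split_edge (G : graph) (x y : vertex G) p e :
  is_path x p y -> uniq (path_edges p) -> e \in path_edges p ->
  exists u v, [/\ connects e u v,
    linked ([set` path_edges p] `\ e) x u & linked ([set` path_edges p] `\ e) v y].
Proof.
elim: p x => [|[f w] p IHp] x //= [fxw pw] /andP[fp up].
rewrite inE => /predU1P[->|ep].
  exists x, w; split=> //; first by exists [::].
  exists p => // e' e'p; split; first by rewrite /= inE e'p orbT.
  by move=> e'f; move: fp; rewrite -e'f => /negP; apply.
have [u [v [euv wu vy]]] := IHp _ pw up ep.
have sub : [set` path_edges p] `\ e `<=` [set` path_edges ((f, w) :: p)] `\ e.
  by move=> e' [e'p ne]; split=> //; rewrite /= inE e'p orbT.
exists u, v; split=> //; last exact: linked_sub sub vy.
apply: linked_trans (linked_sub sub wu).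
exists [:: (f, w)] => // e' /=; rewrite inE => /eqP ->.
split; first by rewrite /= inE eqxx.
by move=> fe; move: fp; rewrite fe => /negP; apply.
Qed.

Lemma path_suffix (G : graph) (x y z : vertex G) p :
  is_path x p y -> uniq (path_vertices x p) -> z \in path_vertices x p ->
  exists q, [/\ is_path z q y, uniq (path_vertices z q) &
    {subset path_edges q <= path_edges p}].
Proof.
elim: p x => [|[e v] p IHp] x px up.
  by rewrite /path_vertices (mem_seq1 (T := {classic _})) => /eqP ->; exists [::].
rewrite in_path_vertices_cons => /predU1P[->|zp]; first by exists ((e, v) :: p); split.
have [_ pv] := px; have /andP[_ uv] := up.
have [q [qz uq qp]] := IHp _ pv uv zp.
by exists q; split=> // f /qp fp; rewrite inE fp orbT.
Qed.

(** Loop erasure: the tail is made simple first, and if it returns to [x], its suffix from [x]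
    replaces the whole walk. *)
Lemma linked_simple (G : graph) (A : set (edge G)) x y : linked A x y ->
  exists p, [/\ is_path x p y, uniq (path_vertices x p) & [set` path_edges p] `<=` A].
Proof.
case=> p; elim: p x => [|[e v] p IHp] x /= => [-> _|[exv pv] pA]; first by exists [::].
have [|q [qv uq qA]] := IHp _ pv; first by move=> f fp; apply: pA; rewrite /= inE fp orbT.
have [xq|xq] := boolP ((x : {classic vertex G}) \in path_vertices v q).
  by have [r [rx ur rq]] := path_suffix qv uq xq; exists r; split=> // f /rq /qA.
exists ((e, v) :: q); split=> //=; first by apply/andP.
move=> f /=; rewrite inE => /predU1P[->|/qA//].
by apply: pA; rewrite /= inE eqxx.
Qed.

(** A simple path from [v] to [u] inside [A] is closed up by [e]. Since [e] is not in [A], the edges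
    stay distinct even when the cycle has length two. *)
Lemma linked_cycle (G : graph) (A : set (edge G)) e u v :
  connects e u v -> ~ A e -> linked A v u ->
  exists2 D : graph_cycle G, cycle_edges D e & cycle_edges D `<=` e |` A.
Proof.
move=> euv nAe /linked_simple[p [pv up pA]].
have pD : is_path u ((e, v) :: p) u by [].
have uvert : uniq (belast (u : {classic vertex G}) (unzip2 ((e, v) :: p))).
  have lastp : last (v : {classic vertex G}) (unzip2 p) = u.
    by elim: p v pv {euv up pA pD} => [|[f w] p IHp] v //= [_ /IHp].
  move: up; rewrite /path_vertices lastI rcons_uniq lastp => /andP[nu ub].
  by apply/andP.
have uedge : uniq (path_edges ((e, v) :: p)).
  apply/andP; split; last exact: simple_uniq_edges pv up.
  by apply/negP => /pA.
exists (@Cycle G u ((e, v) :: p) ltac:(by []) pD uvert uedge).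
  by rewrite /cycle_edges /= inE eqxx.
by move=> f; rewrite /cycle_edges /= inE => /predU1P[->|/pA]; [left|right].
Qed.

(** Going round [C] the other way: the parts after and before [e] are joined at the base point. *)
Lemma cycle_linked (G : graph) (C : graph_cycle G) e u v :
  cycle_edges C e -> connects e u v -> linked (cycle_edges C `\ e) u v.
Proof.
move=> Ce euv.
have [u' [v' [euv' bu vb]]] :=
  path_split_edge (cycle_is_path C) (cycle_uniq_edges C) Ce.
have vu := linked_trans vb bu.
rewrite /connects in euv'; case: euv euv' => -> [] [-> ->] //; exact: linked_sym.
Qed.

(** The two ends of a shared edge are distinct common vertices. *)
Lemma cactus_cycle_eq (G : graph) (C D : graph_cycle G) e : cactus G ->
  cycle_edges C e -> cycle_edges D e -> cycle_edges C = cycle_edges D.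
Proof.
move=> [_ cactusG] Ce De; apply: contrapT => /cactusG sub1.
have euv : connects e (ends e).1 (ends e).2 by left; case: (ends e).
have [uC vC] := path_edge_ends (cycle_is_path C) Ce euv.
have [uD vD] := path_edge_ends (cycle_is_path D) De euv.
by apply: (connects_neq euv); apply: sub1.
Qed.

(** If the first edge of the path is on [C], then [C] has a second edge at [x], which the path can
    only use by returning to [x]. Otherwise [C] lies in the tail. *)
Lemma simple_path_no_cycle (G : graph) (x y : vertex G) p (C : graph_cycle G) :
  is_path x p y -> uniq (path_vertices x p) ->
  ~ cycle_edges C `<=` [set` path_edges p].
Proof.
elim: p x => [|[e v] p IHp] x.
  move=> _ _; case: C => b [|[e w] q] //= ? ? ? ? /(_ e).
  by rewrite /cycle_edges /= inE eqxx => /(_ isT).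
move=> /= [exv pv] /andP[xp up] Cp.
have [Ce|nCe] := pselect (cycle_edges C e); last first.
  apply: (IHp _ pv up) => f Cf; have := Cp _ Cf.
  by rewrite /= inE => /predU1P[fe|//]; case: nCe; rewrite -fe.
have [[|[f w] q] /=] := cycle_linked Ce exv; first by move=> /(connects_neq exv).
move=> [fxw _] /(_ f); rewrite /= inE eqxx => /(_ isT)[Cf fe].
have := Cp _ Cf; rewrite /= inE => /predU1P[//|fp].
by have [xv _] := path_edge_ends pv fp fxw; case/negP: xp.
Qed.

Lemma cactus_cycle_sub (G : graph) (x y : vertex G) (g d : simple_path x y)
    (C : graph_cycle G) e : cactus G ->
  cycle_edges C e -> spath_edges g e -> ~ spath_edges d e ->
  cycle_edges C `<=` spath_edges g `|` spath_edges d.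
Proof.
move=> cactusG Ce ge nde.
have [u [v [euv xu vy]]] := path_split_edge (spath_is_path g)
  (simple_uniq_edges (spath_is_path g) (spath_simple g)) ge.
pose A := (spath_edges g `|` spath_edges d) `\ e.
have gA : spath_edges g `\ e `<=` A by move=> f [gf fe]; split; [left|].
have xy : linked A x y.
  exists (spath_steps d); first exact: spath_is_path.
  by move=> f df; split; [right|move=> fe; apply: nde; rewrite -fe].
(* The route runs along [g] from [v] to [y], back along [d] to [x], and along [g] to [u]. *)
have vu : linked A v u.
  apply: linked_trans (linked_sub gA vy) _.
  by apply: linked_trans (linked_sym xy) (linked_sub gA xu).
have [|D De DA] := linked_cycle euv _ vu; first by case=> _ /(_ erefl).
rewrite (cactus_cycle_eq cactusG Ce De) => f /DA[->|[]//].
by left.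
Qed.

Lemma diverge_sym (G : graph) (A B : set (edge G)) (C : graph_cycle G) :
  diverge A B C -> diverge B A C.
Proof. by move=> [iA iB cover disj]; split=> //; [rewrite setUC|rewrite setIC]. Qed.

(** The second alternative concerns only the share of [g] in [C]; exchanging [g] and [h] yields the
    other share. *)
Lemma diverge_or_sub (G : graph) (x y : vertex G) (g d h : simple_path x y)
    (C : graph_cycle G) : cactus G ->
  diverge (spath_edges g) (spath_edges h) C ->
  diverge (spath_edges g) (spath_edges d) C \/
  spath_edges g `&` cycle_edges C `<=` spath_edges d.
Proof.
move=> cactusG [ig [f [hf Cf]] cover disj].
have exclusive e : cycle_edges C e -> spath_edges g e -> ~ spath_edges h e.
  move=> Ce ge he.
  by have : set0 e by rewrite -disj.
have [|/existsNP[e /not_implyP[[ge Ce] nde]]] := pselect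
  (spath_edges g `&` cycle_edges C `<=` spath_edges d); first by right.
left; have Cgd := cactus_cycle_sub cactusG Ce ge nde.
split=> //.
(* The edge [f] of [h] on [C] is not in [g], so the covering puts it in [d]. *)
- by exists f; split=> //; have [/(exclusive _ Cf)|] := Cgd _ Cf.
- apply/seteqP; split=> [k Ck|k [[]|[]]//].
  by have [] := Cgd _ Ck; [left|right].
(* An edge [k] of [C] on both [g] and [d] is not on [h], so [d] and [h] would cover [C]; but [e]
   lies on neither. *)
- apply/seteqP; split=> [k [[gk Ck] [dk _]]|//].
  have [//|] := cactus_cycle_sub cactusG Ck dk (exclusive _ Ck gk) Ce.
  exact: exclusive.
Qed.

Theorem theorem4 (G : graph) (cactusG : cactus G) (n : nat) (x y : vertex G) :
  Equivalence (@path_sim G n x y).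
Proof.
split.
- move=> g C _ [ig _ _]; rewrite setIid => g0.
  by move: ig; rewrite /intersects g0 => -[].
- by move=> g d gd C nC /diverge_sym; apply: gd.
- move=> g d h gd dh C nC gh.
  have [/(gd _ nC)//|gsub] := diverge_or_sub d cactusG gh.
  have [/diverge_sym/(dh _ nC)//|hsub] := diverge_or_sub d cactusG (diverge_sym gh).
  (* Both shares of [C] now lie in [d], hence so does all of [C]. *)
  apply: (@simple_path_no_cycle _ _ _ _ C (spath_is_path d) (spath_simple d)).
  by case: gh => _ _ -> _ => e [/gsub|/hsub].
Qed.
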